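(* Let $K\subset\mathbb{R}^n$ be a nonempty compact set and let $\lambda$ be a finite Borel measure whose support is exactly $K$ (e.g. the uniform measure on $K$). Let $N\ge1$, let $f_1,\dots,f_N,g_1,\dots,g_N\in\mathbb{R}[x_1,\dots,x_n]$ with each $g_i$ positive on $K$, and let $\rho:=\min_{x\in K}\sum_{i=1}^N f_i(x)/g_i(x)$. Let $U:K\to\mathbb{R}^{2N}$, $U(x)=(f_1(x),g_1(x),\dots,f_N(x),g_N(x))$, denote the coordinates on $\mathbb{R}^{2N}$ by $(u_1,v_1,\dots,u_N,v_N)$, write $u=(u_1,\dots,u_N)$, $v=(v_1,\dots,v_N)$, and let $U_\#\lambda$ be the pushforward of $\lambda$ by $U$. For $s\in\mathbb{N}$ and $\varepsilon>0$ let $\rho^\#_{s}(\varepsilon)$ be the infimum of $\sum_{i=1}^N\int u_i\,\sigma_i(u,v)\,dU_\#\lambda(u,v)$ over all $\sigma_1,\dots,\sigma_N\in\Sigma[u,v]_d$ satisfying $$\Big|\int u^\alpha v^\beta v_i\,\sigma_i\,dU_\#\lambda-\int u^\alpha v^\beta v_1\,\sigma_1\,dU_\#\lambda\Big|\le\varepsilon\quad(|\alpha+\beta|\le s,\ 1<i\le N),\qquad \Big|\int v_1\,\sigma_1\,dU_\#\lambda-1\Big|\le\varepsilon,$$ where $d\ge d_0(s)$. Then, for a well-chosen $d_0(s)$, $$\rho^\#_{s}(\varepsilon)\to\rho\qquad\text{as } s\to\infty \text{ and } \varepsilon\to0 .$$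
   Context: $\Sigma[u,v]_d$ is the set of polynomials in the $2N$ variables $(u,v)$ of total degree at most $2d$ that are finite sums of squares of real polynomials. For $\alpha,\beta\in\mathbb{N}^N$, $u^\alpha v^\beta=\prod_i u_i^{\alpha_i}v_i^{\beta_i}$ and $|\alpha+\beta|=\sum_i(\alpha_i+\beta_i)$. The pushforward is $U_\#\lambda(C)=\lambda(U^{-1}(C))$ for Borel $C\subset\mathbb{R}^{2N}$; all integrals against it are over its support $U(K)$. The integer $d$ (the order of the sums of squares) is any integer with $d\ge d_0(s)$, where $d_0(s)$ is a positive integer depending on $s$; the dependence of $\rho^\#_s(\varepsilon)$ on $d$ is suppressed in the notation. When $N=1$ the constraints indexed by $1<i\le N$ are absent. *)

(* Defs.v *)
From HB Require Import structures.
From mathcomp Require Import all_boot all_order all_algebra.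
(* Without its notations, which conflict with those of mathcomp-analysis. *)
From mathcomp Require Import -(notations) mpoly.
From mathcomp Require Import all_classical all_reals all_analysis.

Set Implicit Arguments.
Unset Strict Implicit.
Unset Printing Implicit Defensive.

Import Order.TTheory GRing.Theory Num.Theory.
Import numFieldNormedType.Exports.

Local Open Scope classical_set_scope.
Local Open Scope ring_scope.

(* 'rV[R]_n with its Borel sigma-algebra. *)
Notation borelRV R n := (g_sigma_algebraType (@open 'rV[R]_n)).

Definition msupport (R : realType) (n : nat)
    (mu : set (borelRV R n) -> \bar R) : set 'rV[R]_n :=
  [set x | forall V : set 'rV[R]_n, open V -> V x -> (0 < mu V)%E].

(* The value 0 is taken only if A has no least element. *)
Definition minimum (R : realType) (A : set R) : R :=
  xget 0 [set m | A m /\ lbound A m].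

Definition peval (R : realType) (n : nat) (p : mpoly n R) (x : 'rV[R]_n) : R :=
  meval (fun j => x ord0 j) p.

(* Recall that msize is the total degree plus one, and 0 for the polynomial 0. *)
Definition sos (R : realType) (n d : nat) : set (mpoly n R) :=
  [set p | (msize p <= (2 * d).+1)%N /\
           exists qs : seq (mpoly n R), p = \sum_(q <- qs) q ^+ 2].

Section SumOfRatios.
Variables (R : realType) (n N : nat).

(* A point of R^(2N) is the row vector (u_1, .., u_N, v_1, .., v_N). *)
Definition ucoord (y : 'rV[R]_(N + N)) (i : 'I_N) : R := y ord0 (lshift N i).
Definition vcoord (y : 'rV[R]_(N + N)) (i : 'I_N) : R := y ord0 (rshift N i).

Definition monom (a b : 'I_N -> nat) (y : 'rV[R]_(N + N)) : R :=
  \prod_i (ucoord y i ^+ a i * vcoord y i ^+ b i).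

Definition sum_ratios (f g : 'I_N -> mpoly n R) (x : 'rV[R]_n) : R :=
  \sum_i peval (f i) x / peval (g i) x.

Definition Umap (f g : 'I_N -> mpoly n R) (x : 'rV[R]_n) : 'rV[R]_(N + N) :=
  row_mx (\row_i peval (f i) x) (\row_i peval (g i) x).

(* Umap is defined on all of R^n; when the support of lambda is K, the set
   Umap @^-1` C and its intersection with K have the same measure. *)
Definition pushU (lambda : set (borelRV R n) -> \bar R)
    (f g : 'I_N -> mpoly n R) : set (borelRV R (N + N)) -> \bar R :=
  pushforward lambda (Umap f g : borelRV R n -> borelRV R (N + N)).

Definition intU (K : set 'rV[R]_n) (lambda : set (borelRV R n) -> \bar R)
    (f g : 'I_N -> mpoly n R) (h : 'rV[R]_(N + N) -> R) : R :=
  fine (\int[pushU lambda f g]_(y in Umap f g @` K) (h y)%:E)%E.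

End SumOfRatios.

Section Hierarchy.
Variables (R : realType) (n N : nat).
Variables (K : set 'rV[R]_n) (lambda : set (borelRV R n) -> \bar R).

(* There are N.+1 ratios, and the index ord0 is the distinguished first one. *)
Variables (f g : 'I_N.+1 -> mpoly n R).

Local Notation int := (intU K lambda f g).

Definition feasible (s d : nat) (eps : R)
    (sigma : 'I_N.+1 -> mpoly (N.+1 + N.+1) R) : Prop :=
  [/\ forall i, sos d (sigma i),
      forall (i : 'I_N.+1) (a b : 'I_N.+1 -> nat),
        i != ord0 -> (\sum_j (a j + b j) <= s)%N ->
        `| int (fun y => monom a b y * vcoord y i * peval (sigma i) y)
           - int (fun y => monom a b y * vcoord y ord0 * peval (sigma ord0) y) |
          <= eps
    & `| int (fun y => vcoord y ord0 * peval (sigma ord0) y) - 1 | <= eps].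

(* The infimum is +oo if there is no feasible point. *)
Definition rho_sharp (s d : nat) (eps : R) : \bar R :=
  ereal_inf [set (\sum_i int (fun y => ucoord y i * peval (sigma i) y))%:E
            | sigma in feasible s d eps].

End Hierarchy.

(* Main.v *)
(** Write nu for the push-forward of lambda on the compact set Y = U(K).

    Lower bound: 1/v_i is a uniform limit on Y of polynomials in v_i (geometric
    series), so up to a small error the objective of a feasible point is
    [sum_i int p_i v_i sigma_i dnu] with fixed polynomials p_i; once s exceeds
    their degrees the constraints replace v_i sigma_i by v_1 sigma_1, and what
    remains, [int (sum_i u_i / v_i) v_1 sigma_1 dnu], is at least
    [rho - |rho| eps].

    Upper bound: since d_0 may not depend on eps, the constraints are solved
    exactly, by densities of the form sigma_i ~ h / v_i with a common h
    concentrated near a minimiser. Only finitely many moments phi_j of h / v_i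
    matter. As 1/v_i is a uniform limit of sums of squares, so is h / v_i, and
    the remaining moment error is removed by adding a small combination of the
    phi_j, which the Gram matrix of the phi_j determines. That combination is
    not a sum of squares, but it becomes one after adding a small multiple of
    [sum_j (1 + phi_j^2) / 2], a term included in h beforehand. *)

Require Import Defs.
From HB Require Import structures.
From mathcomp Require Import all_boot all_order all_algebra.
From mathcomp Require Import -(notations) mpoly.
From mathcomp Require Import all_classical all_reals all_analysis.
From mathcomp Require Import measurable_realfun.
From mathcomp Require Import ring lra.

Set Implicit Arguments.
Unset Strict Implicit.
Unset Printing Implicit Defensive.

Import Order.TTheory GRing.Theory Num.Theory.
Import numFieldNormedType.Exports.

Local Open Scope classical_set_scope.
Local Open Scope ring_scope.

(** * Continuity and integrals on a compact set *)

Section PointwiseContinuity.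
Variables (R : realType) (k : nat).
Implicit Types (Y : set 'rV[R]_k) (h : 'rV[R]_k -> R) (p : mpoly k R).

(** Limits are taken in the ambient space but only at points of [Y]. Quotients such as u_i / v_i
    thus qualify as soon as v_i is nonzero on [Y], and closure properties come directly from those
    of limits. *)
Definition cont_on Y h := forall y, Y y -> h z @[z --> y] --> h y.

Lemma eq_cont_on Y h1 h2 : h1 =1 h2 -> cont_on Y h2 -> cont_on Y h1.
Proof. by move=> /funext ->. Qed.

Lemma cont_on_cst Y (c : R) : cont_on Y (fun=> c).
Proof. by move=> y _; exact: cst_continuous. Qed.

Lemma cont_onD Y h1 h2 : cont_on Y h1 -> cont_on Y h2 ->
  cont_on Y (fun y => h1 y + h2 y).
Proof. by move=> c1 c2 y Yy; exact: (cvgD (c1 y Yy) (c2 y Yy)). Qed.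

Lemma cont_onN Y h : cont_on Y h -> cont_on Y (fun y => - h y).
Proof. by move=> c y Yy; exact: (cvgN (c y Yy)). Qed.

Lemma cont_onB Y h1 h2 : cont_on Y h1 -> cont_on Y h2 ->
  cont_on Y (fun y => h1 y - h2 y).
Proof. by move=> c1 c2; exact/cont_onD/cont_onN. Qed.

Lemma cont_onM Y h1 h2 : cont_on Y h1 -> cont_on Y h2 ->
  cont_on Y (fun y => h1 y * h2 y).
Proof. by move=> c1 c2 y Yy; exact: (cvgM (c1 y Yy) (c2 y Yy)). Qed.

Lemma cont_onX Y h m : cont_on Y h -> cont_on Y (fun y => h y ^+ m).
Proof.
move=> c; elim: m => [|m IH]; first exact: cont_on_cst.
by apply: (eq_cont_on (fun y => exprS _ _)); exact: cont_onM.
Qed.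

Lemma cont_onV Y h : (forall y, Y y -> h y != 0) -> cont_on Y h ->
  cont_on Y (fun y => (h y)^-1).
Proof. by move=> h0 c y Yy; exact: (cvgV (h0 y Yy) (c y Yy)). Qed.

Lemma cont_on_norm Y h : cont_on Y h -> cont_on Y (fun y => `|h y|).
Proof. by move=> c y Yy; exact: (cvg_norm (c y Yy)). Qed.

Lemma cont_on_sum (J : Type) (r : seq J) (P : pred J) Y
    (F : J -> 'rV[R]_k -> R) : (forall j, P j -> cont_on Y (F j)) ->
  cont_on Y (fun y => \sum_(j <- r | P j) F j y).
Proof.
move=> cF; elim: r => [|j r IH].
  by apply: (eq_cont_on (fun y => big_nil _ _ _ _)); exact: cont_on_cst.
case Pj: (P j); last by apply: eq_cont_on IH => y; rewrite big_cons Pj.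
apply: (eq_cont_on (h2 := fun y => F j y + \sum_(i <- r | P i) F i y)) => [y|].
  by rewrite big_cons Pj.
by apply: cont_onD => //; exact: cF.
Qed.

Lemma cont_on_prod (J : Type) (r : seq J) (P : pred J) Y
    (F : J -> 'rV[R]_k -> R) : (forall j, P j -> cont_on Y (F j)) ->
  cont_on Y (fun y => \prod_(j <- r | P j) F j y).
Proof.
move=> cF; elim: r => [|j r IH].
  by apply: (eq_cont_on (fun y => big_nil _ _ _ _)); exact: cont_on_cst.
case Pj: (P j); last by apply: eq_cont_on IH => y; rewrite big_cons Pj.
apply: (eq_cont_on (h2 := fun y => F j y * \prod_(i <- r | P i) F i y)) => [y|].
  by rewrite big_cons Pj.
by apply: cont_onM => //; exact: cF.
Qed.

Lemma cont_on_coord Y (i : 'I_k) : cont_on Y (fun y => y ord0 i).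
Proof. by move=> y _; exact: coord_continuous. Qed.

Lemma cont_on_peval Y p : cont_on Y (peval p).
Proof.
apply: (eq_cont_on (fun y => mevalE _ _)).
apply: cont_on_sum => m _; apply: cont_onM; first exact: cont_on_cst.
by apply: cont_on_prod => i _; exact/cont_onX/cont_on_coord.
Qed.

Lemma cont_on_within Y h : cont_on Y h -> {within Y, continuous h}.
Proof. by move=> c; apply: continuous_in_subspaceT => y /[!inE]; exact: c. Qed.

Lemma compact_bound Y h : compact Y -> cont_on Y h ->
  exists2 M, 0 < M & forall y, Y y -> `|h y| <= M.
Proof.
move=> cY ch.
have /ex_strict_bound_gt0[M M0 /= HM] : bounded_set (h @` Y).
  apply/compact_bounded/continuous_compact => //; exact/cont_on_within.
by exists M => // y Yy; apply/ltW/HM; exists y.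
Qed.

Lemma compact_min Y h : Y !=set0 -> compact Y -> cont_on Y h ->
  exists2 y0, Y y0 & forall y, Y y -> h y0 <= h y.
Proof.
move=> Y0 cY /cont_on_within ch.
have [c /set_mem Yc cmin] := compact_EVT_min Y0 cY ch.
by exists c => // y Yy; apply: cmin; exact: mem_set.
Qed.

Lemma compact_lower_bound_gt0 Y h : compact Y -> cont_on Y h ->
  (forall y, Y y -> 0 < h y) -> exists2 a, 0 < a & forall y, Y y -> a <= h y.
Proof.
move=> cY ch h0; have [Y0|Y0] := pselect (Y !=set0).
  have [c Yc cmin] := compact_min Y0 cY ch.
  by exists (h c) => //; exact: h0.
by exists 1 => // y Yy; exfalso; apply: Y0; exists y.
Qed.

End PointwiseContinuity.

Section BorelRow.
Variables (R : realType) (k : nat).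

Lemma borelRV_open (A : set 'rV[R]_k) :
  open A -> measurable (A : set (borelRV R k)).
Proof. exact: sub_gen_smallest. Qed.

Lemma borelRV_compact (A : set 'rV[R]_k) :
  compact A -> measurable (A : set (borelRV R k)).
Proof.
move=> /(compact_closed (@norm_hausdorff _ _)) cA.
rewrite -(setCK A); apply: measurableC; apply: borelRV_open; exact: closed_openC.
Qed.

(** The preimage of an open interval is the trace on [Y] of an open set, and the compact set [Y] is
    itself Borel. *)
Lemma borelRV_measurable_fun (Y : set (borelRV R k)) (h : 'rV[R]_k -> R) :
  compact (Y : set 'rV[R]_k) -> cont_on Y h ->
  measurable_fun Y (h : borelRV R k -> R).
Proof.
move=> cY /cont_on_within/continuousP ch mY.
apply: (measurability _ (RGenOpens.measurableE R)) mY.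
move=> _ [_ [a [b ->] <-]].
have /open_subspaceP[V oV VY] := ch _ (itv_open a b).
rewrite setIC -VY; apply: measurableI; first exact: borelRV_open.
exact: borelRV_compact.
Qed.

End BorelRow.

Section CompactIntegral.
Variables (R : realType) (k : nat) (Y : set 'rV[R]_k).
Variable nu : {measure set (borelRV R k) -> \bar R}.
Hypotheses (Yc : compact Y) (nuY : (nu Y < +oo)%E).
Implicit Types h : 'rV[R]_k -> R.

Local Notation I h := (Rintegral nu Y h).

Let mY : measurable (Y : set (borelRV R k)). Proof. exact: borelRV_compact. Qed.

Lemma cont_on_integrable h : cont_on Y h -> nu.-integrable Y (EFin \o h).
Proof.
move=> ch; apply: measurable_bounded_integrable => //.
  exact: borelRV_measurable_fun.
have [M _ HM] := compact_bound Yc ch.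
exists M; split=> [|x Mx y Yy]; first exact: num_real.
exact: le_trans (HM y Yy) (ltW Mx).
Qed.

Lemma Rint_ge0 h : (forall y, Y y -> 0 <= h y) -> 0 <= I h.
Proof. exact: (@Rintegral_ge0 _ _ _ nu). Qed.

Lemma Rint_eq h1 h2 : (forall y, Y y -> h1 y = h2 y) -> I h1 = I h2.
Proof. by move=> e; apply: (@eq_Rintegral _ _ _ nu) => y /set_mem; exact: e. Qed.

Lemma Rint_le h1 h2 : cont_on Y h1 -> cont_on Y h2 ->
  (forall y, Y y -> h1 y <= h2 y) -> I h1 <= I h2.
Proof.
by move=> c1 c2; apply: (@le_Rintegral _ _ _ nu) => //; exact: cont_on_integrable.
Qed.

Lemma RintD h1 h2 : cont_on Y h1 -> cont_on Y h2 ->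
  I (fun y => h1 y + h2 y) = I h1 + I h2.
Proof.
by move=> c1 c2; apply: (@RintegralD _ _ _ nu) => //; exact: cont_on_integrable.
Qed.

Lemma RintB h1 h2 : cont_on Y h1 -> cont_on Y h2 ->
  I (fun y => h1 y - h2 y) = I h1 - I h2.
Proof.
by move=> c1 c2; apply: (@RintegralB _ _ _ nu) => //; exact: cont_on_integrable.
Qed.

Lemma RintZ c h : cont_on Y h -> I (fun y => c * h y) = c * I h.
Proof.
by move=> ch; apply: (@RintegralZl _ _ _ nu) => //; exact: cont_on_integrable.
Qed.

Lemma Rint0 : I (fun=> 0) = 0.
Proof. by rewrite Rintegral_cst// mul0r. Qed.

Lemma Rint_sum (J : Type) (r : seq J) (P : pred J) (F : J -> 'rV[R]_k -> R) :
  (forall j, P j -> cont_on Y (F j)) ->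
  I (fun y => \sum_(j <- r | P j) F j y) = \sum_(j <- r | P j) I (F j).
Proof.
move=> cF; elim: r => [|j r IH].
  by rewrite big_nil -[RHS]Rint0; apply: Rint_eq => y _; rewrite big_nil.
rewrite big_cons; case Pj: (P j); last first.
  by rewrite -IH; apply: Rint_eq => y _; rewrite big_cons Pj.
rewrite -IH -RintD; [|exact: cF|exact: cont_on_sum].
by apply: Rint_eq => y _; rewrite big_cons Pj.
Qed.

Lemma Rint_norm_le h1 h2 : cont_on Y h1 -> cont_on Y h2 ->
  (forall y, Y y -> `|h1 y| <= h2 y) -> `|I h1| <= I h2.
Proof.
move=> c1 c2 h12; rewrite ler_norml -mulN1r -RintZ//; apply/andP; split.
- apply: Rint_le => //; first exact/cont_onM/c2/cont_on_cst.
  by move=> y /h12; rewrite ler_norml mulN1r => /andP[].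
- by apply: Rint_le => // y /h12; rewrite ler_norml => /andP[].
Qed.

(* Letting t -> 0 in 2 |q h| <= t h^2 + q^2 / t. *)
Lemma Rint_sqr_eq0 (q h : 'rV[R]_k -> R) : cont_on Y q -> cont_on Y h ->
  I (fun y => q y ^+ 2) = 0 -> I (fun y => q y * h y) = 0.
Proof.
move=> cq ch q0; apply/eqP; rewrite -normr_le0; apply/ler_addgt0Pr => e e0.
rewrite add0r; set H := I (fun y => h y ^+ 2).
have H0 : 0 <= H by apply: Rint_ge0 => y _; exact: sqr_ge0.
have ctX c r : cont_on Y r -> cont_on Y (fun y => c * r y ^+ 2).
  by move=> cr; apply: cont_onM; [exact: cont_on_cst|exact: cont_onX].
(* Chosen so that t H <= e; the + 1 keeps the denominator positive when H = 0. *)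
pose t := e / (H + 1).
have t0 : 0 < t by rewrite divr_gt0// ltr_wpDl.
apply: (@le_trans _ _ (t * H)); last first.
  by rewrite /t -mulrA ger_pMr// mulrC ler_pdivrMr ?mul1r ?ltr_wpDl// lerDl.
have -> : t * H = I (fun y => t * h y ^+ 2 + t^-1 * q y ^+ 2).
  by rewrite RintD ?RintZ ?q0 ?mulr0 ?addr0//; (exact: ctX || exact: cont_onX).
apply: Rint_norm_le; [exact: cont_onM|by apply: cont_onD; exact: ctX|].
move=> y _; rewrite normrM -[h y ^+ 2]real_normK ?num_real//.
rewrite -[q y ^+ 2]real_normK ?num_real//.
set a := `|q y|; set b := `|h y|.
have a0 : 0 <= a by exact: normr_ge0.
have b0 : 0 <= b by exact: normr_ge0.
(* After multiplication by t the claim reads t a b <= (t b)^2 + a^2, which follows from (t b - a)^2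
   >= 0 and t a b >= 0. *)
rewrite -(ler_pM2l t0) mulrDr mulVKf ?gt_eqF//.
have := sqr_ge0 (t * b - a).
have : 0 <= t * (a * b) by exact: mulr_ge0 (ltW t0) (mulr_ge0 a0 b0).
nra.
Qed.

End CompactIntegral.

(** * Uniform limits of sums of squares *)

Section SumsOfSquares.
Variables (R : realType) (k : nat).
Implicit Types (Y : set 'rV[R]_k) (h w : 'rV[R]_k -> R).

Definition is_poly h := exists p : mpoly k R, h = peval p.

(** Degrees are not tracked here; [sos_of_is_sos] recovers an order once the construction is
    finished. *)
Definition is_sos h :=
  exists qs : seq (mpoly k R), h = fun y => \sum_(q <- qs) peval q y ^+ 2.

Lemma is_poly_cst c : is_poly (fun=> c).
Proof. by exists (mpolyC k c); apply/funext => y; rewrite /peval mevalC. Qed.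

Lemma is_poly_coord (i : 'I_k) : is_poly (fun y => y ord0 i).
Proof. by exists (mpolyX R (mnm1 i)); apply/funext => y; rewrite /peval mevalXU. Qed.

Lemma is_polyD h1 h2 : is_poly h1 -> is_poly h2 -> is_poly (fun y => h1 y + h2 y).
Proof.
by move=> [p1 ->] [p2 ->]; exists (p1 + p2); apply/funext => y; rewrite /peval mevalD.
Qed.

Lemma is_polyM h1 h2 : is_poly h1 -> is_poly h2 -> is_poly (fun y => h1 y * h2 y).
Proof.
by move=> [p1 ->] [p2 ->]; exists (p1 * p2); apply/funext => y; rewrite /peval mevalM.
Qed.

Lemma is_polyB h1 h2 : is_poly h1 -> is_poly h2 -> is_poly (fun y => h1 y - h2 y).
Proof.
by move=> [p1 ->] [p2 ->]; exists (p1 - p2); apply/funext => y; rewrite /peval mevalB.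
Qed.

Lemma is_polyX h m : is_poly h -> is_poly (fun y => h y ^+ m).
Proof.
by move=> [p ->]; exists (p ^+ m); apply/funext => y; rewrite /peval rmorphXn.
Qed.

Lemma is_poly_sum (J : Type) (r : seq J) (P : pred J) (F : J -> 'rV[R]_k -> R) :
  (forall j, is_poly (F j)) -> is_poly (fun y => \sum_(j <- r | P j) F j y).
Proof.
move=> /choice[p Fp]; exists (\sum_(j <- r | P j) p j); apply/funext => y.
by rewrite /peval rmorph_sum/=; apply: eq_bigr => j _; rewrite Fp.
Qed.

Lemma is_poly_prod (J : Type) (r : seq J) (P : pred J) (F : J -> 'rV[R]_k -> R) :
  (forall j, is_poly (F j)) -> is_poly (fun y => \prod_(j <- r | P j) F j y).
Proof.
move=> /choice[p Fp]; exists (\prod_(j <- r | P j) p j); apply/funext => y.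
by rewrite /peval rmorph_prod/=; apply: eq_bigr => j _; rewrite Fp.
Qed.

Lemma is_poly_cont Y h : is_poly h -> cont_on Y h.
Proof. by move=> [p ->]; exact: cont_on_peval. Qed.

Lemma is_sos_poly h : is_sos h -> is_poly h.
Proof.
by move=> [qs ->]; apply: is_poly_sum => q; apply: is_polyX; exists q.
Qed.

Lemma is_sos_ge0 h y : is_sos h -> 0 <= h y.
Proof. by move=> [qs ->]; apply: sumr_ge0 => q _; exact: sqr_ge0. Qed.

Lemma is_sos_sqr h : is_poly h -> is_sos (fun y => h y ^+ 2).
Proof. by move=> [p ->]; exists [:: p]; apply/funext => y; rewrite big_seq1. Qed.

Lemma is_sosD h1 h2 : is_sos h1 -> is_sos h2 -> is_sos (fun y => h1 y + h2 y).
Proof.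
by move=> [p1 ->] [p2 ->]; exists (p1 ++ p2); apply/funext => y; rewrite big_cat.
Qed.

Lemma is_sosM h1 h2 : is_sos h1 -> is_sos h2 -> is_sos (fun y => h1 y * h2 y).
Proof.
move=> [p1 ->] [p2 ->]; exists [seq q1 * q2 | q1 <- p1, q2 <- p2].
apply/funext => y; rewrite big_allpairs_dep/= mulr_suml; apply: eq_bigr => q1 _.
by rewrite mulr_sumr; apply: eq_bigr => q2 _; rewrite /peval mevalM exprMn.
Qed.

Lemma is_sos_cst c : 0 <= c -> is_sos (fun=> c).
Proof.
move=> c0; have := is_sos_sqr (is_poly_cst (Num.sqrt c)).
by congr is_sos; apply/funext => y; rewrite sqr_sqrtr.
Qed.

Lemma is_sosZ c h : 0 <= c -> is_sos h -> is_sos (fun y => c * h y).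
Proof. by move=> c0; apply: is_sosM; exact: is_sos_cst. Qed.

Lemma is_sos_sum (J : Type) (r : seq J) (P : pred J) (F : J -> 'rV[R]_k -> R) :
  (forall j, P j -> is_sos (F j)) -> is_sos (fun y => \sum_(j <- r | P j) F j y).
Proof.
move=> sF; elim: r => [|j r IH].
  have := is_sos_cst (lexx 0).
  by congr is_sos; apply/funext => y; rewrite big_nil.
case Pj: (P j); last first.
  by move: IH; congr is_sos; apply/funext => y; rewrite big_cons Pj.
have := is_sosD (sF _ Pj) IH.
by congr is_sos; apply/funext => y; rewrite big_cons Pj.
Qed.

Lemma sos_of_is_sos h : is_sos h -> exists d sigma, sos d sigma /\ h = peval sigma.
Proof.
move=> [qs hE]; pose sigma := \sum_(q <- qs) q ^+ 2.
(* A crude order suffices, as [msize sigma] is at most twice itself plus one. *)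
exists (msize sigma), sigma; split; last first.
  apply/funext => y; rewrite hE /peval rmorph_sum/=.
  by apply: eq_bigr => q _; rewrite rmorphXn.
by split; [rewrite leqW// mul2n -addnn leq_addr|exists qs].
Qed.

(** The closure of the sums of squares in the uniform norm on [Y]; it serves to contain the
    non-polynomial functions 1 / v_i. *)
Definition sos_lim Y w := forall e, 0 < e ->
  exists2 h, is_sos h & forall y, Y y -> `|w y - h y| <= e.

Lemma is_sos_lim Y h : is_sos h -> sos_lim Y h.
Proof. by move=> sh e e0; exists h => // y _; rewrite subrr normr0 ltW. Qed.

Lemma eq_sos_lim Y w1 w2 : (forall y, Y y -> w1 y = w2 y) ->
  sos_lim Y w2 -> sos_lim Y w1.
Proof.
by move=> w12 lw e /lw[h sh He]; exists h => // y Yy; rewrite w12// He.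
Qed.

Lemma sos_limD Y w1 w2 : sos_lim Y w1 -> sos_lim Y w2 ->
  sos_lim Y (fun y => w1 y + w2 y).
Proof.
move=> l1 l2 e e0; have e20 : 0 < e / 2 by rewrite divr_gt0.
have [h1 s1 H1] := l1 _ e20; have [h2 s2 H2] := l2 _ e20.
exists (fun y => h1 y + h2 y); first exact: is_sosD.
move=> y Yy; rewrite opprD addrACA (splitr e).
by rewrite (le_trans (ler_normD _ _))// lerD ?H1 ?H2.
Qed.

Lemma sos_lim_sum Y (J : Type) (r : seq J) (P : pred J)
    (F : J -> 'rV[R]_k -> R) : (forall j, P j -> sos_lim Y (F j)) ->
  sos_lim Y (fun y => \sum_(j <- r | P j) F j y).
Proof.
move=> sF; elim: r => [|j r IH].
  apply: (eq_sos_lim _ (is_sos_lim _ (is_sos_cst (lexx 0)))) => y _.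
  by rewrite big_nil.
case Pj: (P j); last first.
  by apply: (eq_sos_lim _ IH) => y _; rewrite big_cons Pj.
apply: (eq_sos_lim _ (sos_limD (sF _ Pj) IH)) => y _.
by rewrite big_cons Pj.
Qed.

Lemma sos_limM Y w1 w2 : compact Y -> cont_on Y w1 -> cont_on Y w2 ->
  sos_lim Y w1 -> sos_lim Y w2 -> sos_lim Y (fun y => w1 y * w2 y).
Proof.
move=> Yc c1 c2 l1 l2 e e0.
have [B1 B10 HB1] := compact_bound Yc c1.
have [B2 B20 HB2] := compact_bound Yc c2.
(* The error splits as w1 (w2 - h2) + (w1 - h1) h2. With e' <= 1 the factor h2 is bounded by B2 + 1,
   so the total is at most e' S <= e. *)
pose S := B1 + B2 + 1.
have S0 : 0 < S by rewrite /S; lra.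
pose e' := Num.min 1 (e / S).
have e'0 : 0 < e' by rewrite lt_min ltr01 divr_gt0.
have e'1 : e' <= 1 by rewrite ge_min lexx.
have e'S : e' * S <= e by rewrite -ler_pdivlMr// ge_min lexx orbT.
have [h1 s1 H1] := l1 _ e'0; have [h2 s2 H2] := l2 _ e'0.
exists (fun y => h1 y * h2 y); first exact: is_sosM.
move=> y Yy; apply: le_trans e'S.
have -> : w1 y * w2 y - h1 y * h2 y =
    w1 y * (w2 y - h2 y) + (w1 y - h1 y) * h2 y by ring.
have h2B : `|h2 y| <= B2 + 1.
  have -> : h2 y = w2 y - (w2 y - h2 y) by ring.
  rewrite (le_trans (ler_normB _ _))// lerD ?HB2//.
  exact: le_trans (H2 _ Yy) e'1.
have -> : e' * S = B1 * e' + e' * (B2 + 1) by rewrite /S; ring.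
rewrite (le_trans (ler_normD _ _))// !normrM lerD// ler_pM//.
- exact: HB1.
- exact: H2.
- exact: H1.
Qed.

End SumsOfSquares.

Section GeometricSeries.
Variable R : realType.
Implicit Types (a b t x e : R).

Lemma expr_le_eventually x e : 0 <= x < 1 -> 0 < e ->
  exists m0, forall m, (m0 <= m)%N -> x ^+ m <= e.
Proof.
move=> /andP[x0 x1] e0.
have : (fun m : nat => x ^+ m) @ \oo --> (0 : R).
  by apply: cvg_expr; rewrite ger0_norm.
move=> /cvgrPdist_le/(_ _ e0)[m0 _ H]; exists m0 => m /H/=.
by rewrite sub0r normrN ger0_norm ?exprn_ge0.
Qed.

(** With x = 1 - t / b, the partial sum of m terms misses 1 / t by exactly x^m / t, which is at most
    (1 - a / b)^m / a for every t in [a, b]. All large m are allowed so that an odd number of terms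
    can be picked later. *)
Lemma invr_geometric a b e : 0 < a -> a <= b -> 0 < e ->
  exists m0, forall m, (m0 <= m)%N -> forall t, a <= t <= b ->
    `|t^-1 - b^-1 * \sum_(l < m) (1 - t / b) ^+ l| <= e.
Proof.
move=> a0 ab e0; have b0 : 0 < b by exact: lt_le_trans ab.
have x01 : 0 <= 1 - a / b < 1.
  rewrite subr_ge0 ler_pdivrMr// mul1r ab/= ltrBlDr ltrDl; exact: divr_gt0.
have [m0 H] := expr_le_eventually x01 (mulr_gt0 e0 a0).
exists m0 => m /H{}H t /andP[at_ tb].
have t0 : 0 < t by exact: lt_le_trans at_.
set x := 1 - t / b.
have x0 : 0 <= x by rewrite subr_ge0 ler_pdivrMr// mul1r.
have -> : b^-1 * \sum_(l < m) x ^+ l = (1 - x ^+ m) / t.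
  have xE : x - 1 = - (t / b) by rewrite /x; ring.
  have := subrX1 x m; rewrite xE => E.
  have -> : 1 - x ^+ m = t / b * \sum_(l < m) x ^+ l.
    by rewrite -(opprB (x ^+ m)) E; ring.
  by field; rewrite !gt_eqF.
have -> : t^-1 - (1 - x ^+ m) / t = x ^+ m / t by field; rewrite gt_eqF.
rewrite ger0_norm; last by rewrite divr_ge0 ?exprn_ge0 ?(ltW t0).
rewrite ler_pdivrMr//.
apply: (@le_trans _ _ (e * a)); last by rewrite ler_pM2l.
apply: le_trans H; apply: lerXn2r; rewrite ?nnegrE//; first by case/andP: x01.
by rewrite lerD2l lerN2 ler_pM2r ?invr_gt0.
Qed.

(** Each x^(2j) (1 + x)^2 expands to x^(2j) + 2 x^(2j+1) + x^(2j+2). Summed over j, every power is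
    counted twice except the end terms 1 and x^(2m), which the two extra squares complete. No sign
    of x is involved. *)
Lemma geometric_sum_sos x m : \sum_(l < (2 * m)%N.+1) x ^+ l =
  2^-1 * (1 + (x ^+ m) ^+ 2 + \sum_(j < m) (x ^+ j * (1 + x)) ^+ 2).
Proof.
elim: m => [|m IH].
  by rewrite muln0 big_ord_recr !big_ord0 /= expr0; field.
rewrite mulnS 2!big_ord_recr IH /= big_ord_recr /=.
have -> : x ^+ (2 * m)%N.+1 = x * (x ^+ m) ^+ 2.
  by rewrite exprS [(2 * m)%N]mulnC exprM.
have -> : x ^+ (2 * m)%N.+2 = x * x * (x ^+ m) ^+ 2.
  by rewrite exprS exprS -mulrA [(2 * m)%N]mulnC exprM mulrA.
by rewrite [x ^+ m.+1]exprS; field.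
Qed.

End GeometricSeries.

Section InverseSosLimit.
Variables (R : realType) (k : nat) (Y : set 'rV[R]_k) (v : 'rV[R]_k -> R).
Hypotheses (Yc : compact Y) (pv : is_poly v) (v_gt0 : forall y, Y y -> 0 < v y).

Lemma pos_bounds : exists a b, [/\ 0 < a, a <= b & forall y, Y y -> a <= v y <= b].
Proof.
have cv : cont_on Y v by exact: is_poly_cont.
have [a a0 Ha] := compact_lower_bound_gt0 Yc cv v_gt0.
have [b b0 Hb] := compact_bound Yc cv.
(* The maximum guarantees a <= b even when [Y] is empty. *)
exists a, (Num.max a b); split=> // [|y Yy]; first by rewrite le_max lexx.
rewrite Ha//= le_max; apply/orP; right.
by apply: le_trans (Hb _ Yy); exact: ler_norm.
Qed.

Lemma cont_on_invr : cont_on Y (fun y => (v y)^-1).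
Proof.
by apply: cont_onV; [move=> y /v_gt0/lt0r_neq0|exact: is_poly_cont].
Qed.

(** A geometric series cut after an odd number of terms is a sum of squares by
    [geometric_sum_sos]. *)
Lemma sos_limV : sos_lim Y (fun y => (v y)^-1).
Proof.
have [a [b [a0 ab Hab]]] := pos_bounds.
have b0 : 0 < b by exact: lt_le_trans ab.
move=> e e0; have [m0 H] := invr_geometric a0 ab e0.
exists (fun y => b^-1 * \sum_(l < (2 * m0)%N.+1) (1 - v y / b) ^+ l); last first.
  by move=> y Yy; apply: H (Hab _ Yy); rewrite leqW// mul2n -addnn leq_addr.
apply: is_sosZ; first by rewrite invr_ge0 ltW.
have px : is_poly (fun y => 1 - v y / b).
  by apply: is_polyB (is_poly_cst _ _) _; apply: is_polyM pv (is_poly_cst _ _).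
have -> : (fun y => \sum_(l < (2 * m0)%N.+1) (1 - v y / b) ^+ l) =
  (fun y => 2^-1 * (1 + ((1 - v y / b) ^+ m0) ^+ 2 +
    \sum_(j < m0) ((1 - v y / b) ^+ j * (1 + (1 - v y / b))) ^+ 2)).
  by apply/funext => y; exact: geometric_sum_sos.
apply: is_sosZ; first by rewrite invr_ge0.
apply: is_sosD; last first.
  apply: is_sos_sum => j _; apply: is_sos_sqr; apply: is_polyM.
    exact: is_polyX.
  exact: is_polyD (is_poly_cst _ _) px.
apply: is_sosD; first exact: is_sos_cst.
exact/is_sos_sqr/is_polyX.
Qed.

(* v = v^2 * (1/v). *)
Lemma sos_lim_pos : sos_lim Y v.
Proof.
have l2 : sos_lim Y (fun y => v y ^+ 2) by exact/is_sos_lim/is_sos_sqr.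
have c2 : cont_on Y (fun y => v y ^+ 2) by exact/cont_onX/is_poly_cont.
apply: (eq_sos_lim _ (sos_limM Yc c2 cont_on_invr l2 sos_limV)) => y /v_gt0 vy.
by rewrite expr2 mulfK// gt_eqF.
Qed.

End InverseSosLimit.

(** * Exact matching of finitely many moments *)

Section Matching.
Variables (R : realType) (k : nat) (Y : set 'rV[R]_k).
Variable nu : {measure set (borelRV R k) -> \bar R}.
Hypotheses (Yc : compact Y) (nuY : (nu Y < +oo)%E).

Local Notation I h := (Rintegral nu Y h).

Section Gram.
Variables (M : nat) (phi : 'I_M -> 'rV[R]_k -> R).
Hypothesis phi_poly : forall j, is_poly (phi j).

Let cphi j : cont_on Y (phi j). Proof. exact: is_poly_cont. Qed.

Definition gram : 'M[R]_M := \matrix_(i, j) I (fun y => phi i y * phi j y).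

Definition coeffs (u : 'rV[R]_k -> R) : 'rV[R]_M :=
  \row_j I (fun y => phi j y * u y).

(* If x is in the kernel of the Gram matrix then q = sum_j x_j phi_j satisfies
   I (q^2) = 0, so that I (q u) = 0. *)
Lemma coeffs_sub_gram (u : 'rV[R]_k -> R) : cont_on Y u ->
  (coeffs u <= gram)%MS.
Proof.
move=> cu; rewrite submxE; apply/eqP/rowP => l; rewrite !mxE.
(* Lying in the row space of [gram] means annihilating each column x of its cokernel; such a column
   satisfies gram x = 0. *)
pose x j := cokermx gram j l; pose q y := \sum_j x j * phi j y.
have cxphi j : cont_on Y (fun y => x j * phi j y).
  by apply: cont_onM => //; exact: cont_on_cst.
have cq : cont_on Y q by apply: cont_on_sum => j _.
have Iq w : cont_on Y w ->
    I (fun y => q y * w y) = \sum_j x j * I (fun y => phi j y * w y).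
  move=> cw; transitivity (I (fun y => \sum_j x j * (phi j y * w y))).
    apply: Rint_eq => y _; rewrite mulr_suml; apply: eq_bigr => j _.
    by rewrite mulrA.
  rewrite Rint_sum//; last first.
    by move=> j _; apply: cont_onM; [exact: cont_on_cst|exact: cont_onM].
  by apply: eq_bigr => j _; rewrite RintZ//; exact: cont_onM.
under eq_bigr do rewrite mxE mulrC.
rewrite -Iq//; apply: Rint_sqr_eq0 => //.
transitivity (I (fun y => q y * q y)); first by apply: Rint_eq => y _; rewrite expr2.
rewrite Iq//; apply: big1 => i _.
(* I (q phi_i) is the i-th entry of gram x, hence zero. *)
transitivity (x i * (\sum_j gram i j * x j)); last first.
  have /matrixP/(_ i l) := mulmx_coker gram.
  by rewrite !mxE => ->; rewrite mulr0.
congr (_ * _); transitivity (I (fun y => q y * phi i y)).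
  by apply: Rint_eq => y _; rewrite mulrC.
rewrite Iq//; apply: eq_bigr => j _; rewrite mxE mulrC; congr (_ * _).
by apply: Rint_eq => y _; rewrite mulrC.
Qed.

Definition theta (y : 'rV[R]_k) : R := \sum_j 2^-1 * (1 + phi j y ^+ 2).

Lemma theta_sos : is_sos theta.
Proof.
apply: is_sos_sum => j _; apply: is_sosZ; first by rewrite invr_ge0.
by apply: is_sosD; [exact: is_sos_cst|exact: is_sos_sqr].
Qed.

(* A sum of squares close to w is corrected by the combination of the phi_j
   solving the Gram system; delta * theta absorbs it, since
   delta (1 + phi^2) / 2 + c phi
     = (delta + c) ((1 + phi) / 2)^2 + (delta - c) ((1 - phi) / 2)^2. *)
Lemma sos_matching_ord (w : 'rV[R]_k -> R) (delta : R) :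
    cont_on Y w -> sos_lim Y w -> 0 < delta ->
  exists2 h, is_sos h & forall j,
    I (fun y => phi j y * h y) = I (fun y => phi j y * (w y + delta * theta y)).
Proof.
move=> cw lw d0.
pose B i := I (fun y => `|phi i y|).
have cabs i : cont_on Y (fun y => `|phi i y|).
  exact: cont_on_norm.
have B0 i : 0 <= B i by apply: Rint_ge0 => y _.
(* An error of at most delta / C between w and the sum of squares forces every coefficient c_j of
   the correction below delta in absolute value. *)
pose C := 1 + \sum_i \sum_j B i * `|pinvmx gram i j|.
have C0 : 0 < C.
  rewrite ltr_pwDl// sumr_ge0// => i _; rewrite sumr_ge0// => j _.
  exact: mulr_ge0.
have [s0 s0s Hs0] := lw _ (divr_gt0 d0 C0).
have cs0 : cont_on Y s0 by exact/is_poly_cont/is_sos_poly.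
pose u y := w y - s0 y.
have cu : cont_on Y u by exact: cont_onB.
pose c := coeffs u *m pinvmx gram.
have cG : c *m gram = coeffs u by rewrite mulmxKpV// coeffs_sub_gram.
have c_small j : `|c ord0 j| <= delta.
  rewrite mxE (le_trans (ler_norm_sum _ _ _))//.
  apply: (@le_trans _ _ (\sum_i (delta / C) * (B i * `|pinvmx gram i j|))).
    apply: ler_sum => i _; rewrite normrM mulrA ler_wpM2r// mxE.
    rewrite /B -RintZ//; apply: Rint_norm_le => //.
    - exact: cont_onM.
    - by apply: cont_onM => //; exact: cont_on_cst.
    - by move=> y Yy; rewrite normrM mulrC ler_wpM2r// Hs0.
  rewrite -mulr_sumr -mulrA ger_pMr// mulrC ler_pdivrMr// mul1r /C.
  rewrite ler_wpDl// ler_sum// => i _; rewrite (bigD1 j)//= lerDl.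
  by rewrite sumr_ge0// => l _; exact: mulr_ge0.
pose h y := s0 y + \sum_j ((delta + c ord0 j) * (2^-1 * (1 + phi j y)) ^+ 2
                         + (delta - c ord0 j) * (2^-1 * (1 - phi j y)) ^+ 2).
have hE y : h y = s0 y + delta * theta y + \sum_j c ord0 j * phi j y.
  rewrite /h /theta mulr_sumr -addrA -big_split/=; congr (_ + _).
  by apply: eq_bigr => j _; field.
exists h.
  apply: is_sosD => //; apply: is_sos_sum => j _.
  have /andP[c1 c2] : (- delta <= c ord0 j) && (c ord0 j <= delta).
    by rewrite -ler_norml.
  apply: is_sosD; apply: is_sosZ; try lra; apply: is_sos_sqr;
    apply: is_polyM; try exact: is_poly_cst.
  - by apply: is_polyD => //; exact: is_poly_cst.
  - by apply: is_polyB => //; exact: is_poly_cst.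
move=> j; have ctheta : cont_on Y theta by exact/is_poly_cont/is_sos_poly/theta_sos.
have cdt : cont_on Y (fun y => delta * theta y).
  by apply: cont_onM => //; exact: cont_on_cst.
have cS : cont_on Y (fun y => s0 y + delta * theta y) by exact: cont_onD.
have ccphi i : cont_on Y (fun y => c ord0 i * phi i y).
  by apply: cont_onM => //; exact: cont_on_cst.
have csum : cont_on Y (fun y => \sum_i c ord0 i * phi i y).
  by apply: cont_on_sum => i _.
transitivity (I (fun y => phi j y * (s0 y + delta * theta y)
    + phi j y * \sum_i c ord0 i * phi i y)).
  by apply: Rint_eq => y _; rewrite hE mulrDr.
rewrite RintD//; [|exact: cont_onM|exact: cont_onM].
(* As c solves the Gram system, the correction has exactly the moments of the error u = w - s0. *)
have -> : I (fun y => phi j y * \sum_i c ord0 i * phi i y) =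
    I (fun y => phi j y * u y).
  transitivity ((c *m gram) ord0 j); last by rewrite cG mxE.
  rewrite mxE.
  transitivity (I (fun y => \sum_i c ord0 i * (phi i y * phi j y))).
    apply: Rint_eq => y _; rewrite mulr_sumr; apply: eq_bigr => i _; ring.
  rewrite Rint_sum//; last first.
    by move=> i _; apply: cont_onM; [exact: cont_on_cst|exact: cont_onM].
  by apply: eq_bigr => i _; rewrite RintZ ?mxE//; exact: cont_onM.
rewrite -RintD//; [|exact: cont_onM|exact: cont_onM].
by apply: Rint_eq => y _; rewrite /u; ring.
Qed.

End Gram.

Section Family.
Variables (J : finType) (phi : J -> 'rV[R]_k -> R).
Hypothesis phi_poly : forall j, is_poly (phi j).

(** The function t depends on the family alone and precedes w and delta. This order of quantifiers
    is what later allows the target w to be built from delta and from the functions t of the other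
    indices. *)
Lemma sos_matching : exists2 t, is_sos t & forall w delta,
    cont_on Y w -> sos_lim Y w -> 0 < delta ->
  exists2 h, is_sos h & forall j,
    I (fun y => phi j y * h y) = I (fun y => phi j y * (w y + delta * t y)).
Proof.
pose phi' (i : 'I_#|J|) := phi (enum_val i).
have phi'_poly i : is_poly (phi' i) by exact: phi_poly.
exists (theta phi'); first exact: theta_sos.
move=> w delta cw lw d0.
have [h sh H] := sos_matching_ord phi'_poly cw lw d0.
by exists h => // j; have := H (enum_rank j); rewrite /phi' enum_rankK.
Qed.

End Family.
End Matching.

(** * Sums of squares concentrated at a point *)

Section Peak.
Variables (R : realType) (k : nat) (Y : set 'rV[R]_k).
Variable nu : {measure set (borelRV R k) -> \bar R}.
Hypotheses (Yc : compact Y) (nuY : (nu Y < +oo)%E).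

Local Notation I h := (Rintegral nu Y h).

(** Integrates the pointwise bound A - c 1_B; the indicator is not continuous, so its integrability
    is obtained from boundedness and measurability. *)
Lemma Rint_le_indic (h : 'rV[R]_k -> R) (B : set 'rV[R]_k) (A c : R) :
    cont_on Y h -> open B -> (forall y, Y y -> h y <= A) ->
    (forall y, Y y -> B y -> h y <= A - c) ->
  I h <= A * fine (nu Y) - c * fine (nu (B `&` Y)).
Proof.
move=> ch oB hA hB.
have mY : measurable (Y : set (borelRV R k)) by exact: borelRV_compact.
have mB : measurable (B : set (borelRV R k)) by exact: borelRV_open.
have iA : nu.-integrable Y (EFin \o (fun=> A)).
  by apply: cont_on_integrable => //; exact: cont_on_cst.
have iB : nu.-integrable Y (EFin \o (\1_B : borelRV R k -> R)).
  apply: measurable_bounded_integrable => //.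
  exists 1; split=> // x x1 y _; rewrite /= indicE.
  by apply: le_trans (ltW x1); case: (_ \in _); rewrite ?normr1 ?normr0.
have icB : nu.-integrable Y (EFin \o (fun y => c * (\1_B : borelRV R k -> R) y)).
  exact: (@integrableZl _ _ _ nu _ mY c _ iB).
have -> : A * fine (nu Y) - c * fine (nu (B `&` Y)) =
    I (fun y => A - c * \1_B y).
  rewrite (@RintegralB _ _ _ nu)// (@RintegralZl _ _ _ nu)//.
  rewrite (@Rintegral_cst _ _ _ nu)//.
  by rewrite /Rintegral (@integral_indic _ _ _ nu).
apply: (@le_Rintegral _ _ _ nu) => //.
- exact: cont_on_integrable.
- exact: (@integrableB _ _ _ nu _ mY _ _ iA icB).
move=> y Yy; rewrite indicE; case: (boolP (y \in B)) => yB.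
  by rewrite mulr1; apply: hB => //; exact/set_mem.
by rewrite mulr0 subr0; exact: hA.
Qed.

Variable y0 : 'rV[R]_k.
Hypothesis mass : forall e : R, 0 < e -> (0 < nu (ball y0 e `&` Y))%E.

(** The squared Euclidean distance to y0, a polynomial, whereas [ball] refers to the sup norm. The
    next inequalities compare the two, at the price of a factor k. *)
Let D (y : 'rV[R]_k) := \sum_j (y ord0 j - y0 ord0 j) ^+ 2.

Let D_poly : is_poly D.
Proof.
apply: is_poly_sum => j; apply: is_polyX; apply: is_polyB.
  exact: is_poly_coord.
exact: is_poly_cst.
Qed.

Let D_ge0 y : 0 <= D y. Proof. by apply: sumr_ge0 => j _; exact: sqr_ge0. Qed.

Let D_lt_ball y (e : R) : 0 < e -> D y < e ^+ 2 -> ball y0 e y.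
Proof.
move=> e0 De; split=> // i j; rewrite ord1.
rewrite /ball/= distrC -(@ltr_pXn2r _ 2) ?nnegrE ?normr_ge0 ?(ltW e0)//.
rewrite real_normK ?num_real//; apply: le_lt_trans De.
by rewrite /D (bigD1 j)//= lerDl; apply: sumr_ge0 => l _; exact: sqr_ge0.
Qed.

Let ball_D_le y (e : R) : ball y0 e y -> D y <= k%:R * e ^+ 2.
Proof.
move=> [e0 H]; apply: (@le_trans _ _ (\sum_(j < k) e ^+ 2)).
  apply: ler_sum => j _; rewrite -[leLHS]real_normK ?num_real//.
  have := H ord0 j; rewrite /ball/= distrC => /ltW Hj.
  by rewrite ler_pXn2r ?nnegrE ?normr_ge0 ?(ltW e0)//.
by rewrite sumr_const card_ord mulr_natl.
Qed.

(* The weight (M - |y - y0|^2)^(2m) concentrates at y0 as m grows. *)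
Lemma sos_peak (r : 'rV[R]_k -> R) : Y y0 -> cont_on Y r -> r y0 < 0 ->
  exists2 t, is_sos t & I (fun y => r y * t y) < 0.
Proof.
move=> Yy0 cr r0; pose c := - r y0 / 2.
have c0 : 0 < c by rewrite /c; lra.
have [e e0 He] : exists2 e, 0 < e & forall y, ball y0 e y -> r y <= - c.
  have /cvgrPdist_lt/(_ _ c0)/nbhs_ballP[e e0 H] := cr _ Yy0.
  exists e => // y /H/=; rewrite ltr_norml => /andP[+ _]; rewrite /c; lra.
pose K : R := k%:R; have K0 : 0 <= K by exact: ler0n.
(* Small enough that D <= K z^2 <= e^2 / 2 on the ball of radius z. *)
pose z := e / (2 * (K + 1)).
have z0 : 0 < z by rewrite divr_gt0// mulr_gt0// ltr_wpDl.
have eE : e = 2 * (K + 1) * z.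
  by rewrite /z mulrC divfK// gt_eqF// mulr_gt0// ltr_wpDl.
have ze : z <= e by rewrite eE; nra.
have Kz : K * z ^+ 2 <= e ^+ 2 / 2 by rewrite eE; nra.
have [B B0 HB] := compact_bound Yc cr.
have cD : cont_on Y D by exact: is_poly_cont.
have [M0 M00 HM0] := compact_bound Yc cD.
(* M - D is nonnegative on [Y]; a and b below are its values where D equals e^2 and e^2 / 2. *)
pose M := M0 + e ^+ 2.
have e20 : 0 < e ^+ 2 by exact: exprn_gt0.
pose a := M - e ^+ 2; pose b := M - e ^+ 2 / 2.
have a0 : 0 < a by rewrite /a /M; lra.
have ab : a < b by rewrite /a /b; lra.
have b0 : 0 < b by exact: lt_trans ab.
have MD y : Y y -> 0 <= M - D y.
  move=> /HM0/(le_trans (ler_norm _)); rewrite /M => H; lra.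
pose V := fine (nu Y).
have V0 : 0 <= V by exact: fine_ge0.
pose mz := fine (nu (ball y0 z `&` Y)).
have mz0 : 0 < mz.
  apply: fine_gt0; rewrite mass//=; apply: le_lt_trans nuY.
  apply: le_measure => //; rewrite inE.
  - apply: measurableI; first by apply: borelRV_open; exact: ball_open.
    exact: borelRV_compact.
  - exact: borelRV_compact.
have x01 : 0 <= (a / b) ^+ 2 < 1.
  rewrite sqr_ge0/= expr_lt1// ?divr_ge0 ?ltW//.
  by rewrite ltr_pdivrMr// mul1r.
have BV0 : 0 < B * V + 1 by rewrite ltr_wpDl// mulr_ge0// ltW.
(* The exponent makes a^(2m) (B V + 1) <= c mz b^(2m): the gain on the small ball, of mass mz,
   outweighs the possible loss far from y0. *)
have [m0 Hm] := expr_le_eventually x01 (divr_gt0 (mulr_gt0 c0 mz0) BV0).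
have {Hm} := Hm m0 (leqnn _); set m := m0 => Hm.
pose t y := ((M - D y) ^+ m) ^+ 2.
have t_ge0 y : 0 <= t y by exact: sqr_ge0.
have ts : is_sos t.
  apply: is_sos_sqr; apply: is_polyX; apply: is_polyB => //.
  exact: is_poly_cst.
exists t => //.
have ct : cont_on Y t by exact/is_poly_cont/is_sos_poly.
set A := (a ^+ m) ^+ 2; set A' := (b ^+ m) ^+ 2.
have A_gt0 : 0 < A by rewrite exprn_gt0// exprn_gt0.
have A0 := ltW A_gt0.
have A'0 : 0 < A' by rewrite exprn_gt0// exprn_gt0.
have t_le y : Y y -> e ^+ 2 <= D y -> t y <= A.
  move=> Yy De; rewrite /t /A.
  apply: lerXn2r; rewrite ?nnegrE ?exprn_ge0 ?MD ?(ltW a0)//.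
  by apply: lerXn2r; rewrite ?nnegrE ?MD ?(ltW a0)// /a lerD2l lerN2.
have t_ge y : Y y -> D y <= e ^+ 2 / 2 -> A' <= t y.
  move=> Yy De; rewrite /t /A'.
  apply: lerXn2r; rewrite ?nnegrE ?exprn_ge0 ?MD ?(ltW b0)//.
  by apply: lerXn2r; rewrite ?nnegrE ?MD ?(ltW b0)// /b lerD2l lerN2.
have BA0 : 0 <= B * A by exact: mulr_ge0 (ltW B0) A0.
(* Where D >= e^2 the integrand is at most B A; where D < e^2 it is nonpositive; on the ball of
   radius z it is at most - c A'. *)
have : I (fun y => r y * t y) <= B * A * V - (B * A + c * A') * mz.
  apply: Rint_le_indic; [exact: cont_onM|exact: ball_open| |].
  - move=> y Yy; have ty := t_ge0 y.
    case: (leP (e ^+ 2) (D y)) => De.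
      have := t_le _ Yy De; have := le_trans (ler_norm _) (HB _ Yy).
      nra.
    have := He _ (D_lt_ball e0 De); nra.
  - move=> y Yy /[dup] /ball_D_le Dz yz; rewrite opprD addrA subrr add0r.
    have := t_ge _ Yy (le_trans Dz Kz).
    have := He _ (le_ball ze yz); nra.
move=> /le_lt_trans; apply.
have AA' : A * (B * V + 1) <= c * mz * A'.
  move: Hm; rewrite ler_pdivlMr// => Hm.
  have -> : A = (a / b) ^+ 2 ^+ m * A'.
    by rewrite /A /A' [_ ^+ 2 ^+ m]exprAC -!exprMn divfK ?gt_eqF.
  by rewrite mulrAC ler_pM2r.
have BAmz : 0 <= B * A * mz by exact: mulr_ge0 BA0 (ltW mz0).
have -> : B * A * V - (B * A + c * A') * mz =
    A * (B * V + 1) - c * mz * A' - A - B * A * mz by ring.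
lra.
Qed.

End Peak.

(** * Exactly feasible densities *)

Section RatioCoordinates.
Variables (R : realType) (N : nat).
Implicit Types (y : 'rV[R]_(N + N)) (i : 'I_N).

Lemma is_poly_ucoord i : is_poly (fun y : 'rV[R]_(N + N) => ucoord y i).
Proof. exact: is_poly_coord. Qed.

Lemma is_poly_vcoord i : is_poly (fun y : 'rV[R]_(N + N) => vcoord y i).
Proof. exact: is_poly_coord. Qed.

Lemma is_poly_monom a b : is_poly (@monom R N a b).
Proof.
apply: is_poly_prod => i; apply: is_polyM; apply: is_polyX.
  exact: is_poly_ucoord.
exact: is_poly_vcoord.
Qed.

Lemma sosW (k d d' : nat) (p : mpoly k R) : (d <= d')%N -> sos d p -> sos d' p.
Proof.
move=> dd' [pd ps]; split => //; apply: leq_trans pd _.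
by rewrite ltnS leq_mul2l.
Qed.

Definition ratio_sum y : R := \sum_i ucoord y i / vcoord y i.

Variables (Y : set 'rV[R]_(N + N)).
Hypothesis v_gt0 : forall y i, Y y -> 0 < vcoord y i.

Lemma cont_on_invv i : cont_on Y (fun y => (vcoord y i)^-1).
Proof.
apply: cont_on_invr; first exact: is_poly_vcoord.
by move=> y; exact: v_gt0.
Qed.

Lemma cont_on_ratio i : cont_on Y (fun y => ucoord y i / vcoord y i).
Proof.
by apply: cont_onM; [exact/is_poly_cont/is_poly_ucoord|exact: cont_on_invv].
Qed.

Lemma cont_on_ratio_sum : cont_on Y ratio_sum.
Proof. by apply: cont_on_sum => i _; exact: cont_on_ratio. Qed.

End RatioCoordinates.

Section ExactDensities.
Variables (R : realType) (N : nat) (Y : set 'rV[R]_(N.+1 + N.+1)).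
Variable nu : {measure set (borelRV R (N.+1 + N.+1)) -> \bar R}.
Hypotheses (Yc : compact Y) (nuY : (nu Y < +oo)%E).
Hypothesis v_gt0 : forall y i, Y y -> 0 < vcoord y i.
Variable y0 : 'rV[R]_(N.+1 + N.+1).
Hypothesis Yy0 : Y y0.
Hypothesis mass : forall e : R, 0 < e -> (0 < nu (ball y0 e `&` Y))%E.

Local Notation I h := (Rintegral nu Y h).

(** The constraints hold with equality, so no eps enters. Once eta is chosen as a function of s, the
    order d depends on s alone. *)
Lemma exact_densities (s : nat) (eta : R) : 0 < eta ->
  exists d (sigma : 'I_N.+1 -> mpoly (N.+1 + N.+1) R),
  [/\ forall i, sos d (sigma i),
      forall i (a b : 'I_N.+1 -> nat), (\sum_j (a j + b j) <= s)%N ->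
        I (fun y => monom a b y * vcoord y i * peval (sigma i) y) =
        I (fun y => monom a b y * vcoord y ord0 * peval (sigma ord0) y),
      I (fun y => vcoord y ord0 * peval (sigma ord0) y) = 1
    & \sum_i I (fun y => ucoord y i * peval (sigma i) y) <=
        ratio_sum y0 + eta].
Proof.
move=> eta0.
(* Each exponent is bounded by s separately: a finite type that covers all exponents of total degree
   at most s. *)
pose X := {ffun 'I_N.+1 -> 'I_s.+1}.
(* [Some] gives the test functions of the constraints, [None] that of the objective. *)
pose phi i (j : option (X * X)) (y : 'rV[R]_(N.+1 + N.+1)) : R :=
  if j is Some ab then
    monom (fun l => ab.1 l : nat) (fun l => ab.2 l : nat) y * vcoord y i
  else ucoord y i.
have phi_poly i j : is_poly (phi i j).
  case: j => [[a b]|]; last exact: is_poly_ucoord.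
  by apply: is_polyM; [exact: is_poly_monom|exact: is_poly_vcoord].
have cphi i j : cont_on Y (phi i j) by exact: is_poly_cont.
have /choice[t Ht] : forall i, exists t, is_sos t /\ forall w delta,
    cont_on Y w -> sos_lim Y w -> 0 < delta ->
    exists2 h, is_sos h & forall j,
      I (fun y => phi i j y * h y) = I (fun y => phi i j y * (w y + delta * t y)).
  by move=> i; have [t] := sos_matching Yc nuY (phi_poly i); exists t.
have ts i : is_sos (t i) by case: (Ht i).
have ct i : cont_on Y (t i) by exact/is_poly_cont/is_sos_poly.
have cu i : cont_on Y (fun y => ucoord y i) by exact/is_poly_cont/is_poly_ucoord.
have cv i : cont_on Y (fun y => vcoord y i) by exact/is_poly_cont/is_poly_vcoord.
have civ i : cont_on Y (fun y => (vcoord y i)^-1) by exact: cont_on_invv.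
have cvt i : cont_on Y (fun y => vcoord y i * t i y) by exact: cont_onM.
pose T y := \sum_i vcoord y i * t i y.
have cT : cont_on Y T by apply: cont_on_sum => i _.
(* Negative at y0. A density h with I (r h) < 0 has, once normalised, objective below ratio_sum y0 +
   eta. *)
pose r (y : 'rV[R]_(N.+1 + N.+1)) := ratio_sum y - (ratio_sum y0 + eta).
have cr : cont_on Y r.
  by apply: cont_onB; [exact: cont_on_ratio_sum|exact: cont_on_cst].
have [tau taus Itau] : exists2 tau, is_sos tau & I (fun y => r y * tau y) < 0.
  by apply: (sos_peak Yc nuY mass Yy0 cr); rewrite /r; lra.
have ctau : cont_on Y tau by exact/is_poly_cont/is_sos_poly.
(* Small enough that adding delta T to tau leaves the integral against r negative. *)
pose delta := - I (fun y => r y * tau y) / (`|I (fun y => r y * T y)| + 1).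
have n0 : 0 < `|I (fun y => r y * T y)| + 1 by rewrite ltr_wpDl.
have delta0 : 0 < delta by rewrite divr_gt0// oppr_gt0.
pose h y := tau y + delta * T y.
have cdT : cont_on Y (fun y => delta * T y).
  by apply: cont_onM => //; exact: cont_on_cst.
have ch : cont_on Y h by exact: cont_onD.
have Irh : I (fun y => r y * h y) < 0.
  have -> : I (fun y => r y * h y) =
      I (fun y => r y * tau y) + delta * I (fun y => r y * T y).
    have crT : cont_on Y (fun y => r y * T y) by exact: cont_onM.
    rewrite -RintZ// -RintD//; [|exact: cont_onM|].
      by apply: Rint_eq => y _; rewrite /h; ring.
    by apply: cont_onM => //; exact: cont_on_cst.
  rewrite -ltrBDl sub0r (le_lt_trans (ler_norm _))// normrM gtr0_norm//.
  rewrite /delta mulrAC ltr_pdivrMr// ltr_pM2l ?oppr_gt0//.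
  by rewrite ltrDl.
have h_ge0 y : Y y -> 0 <= h y.
  move=> Yy; rewrite addr_ge0 ?is_sos_ge0// mulr_ge0 ?(ltW delta0)//.
  apply: sumr_ge0 => i _.
  by rewrite mulr_ge0 ?is_sos_ge0// ltW// v_gt0.
pose Z := I h.
(* The nonzero integral I (r h) is bounded by B Z in absolute value. *)
have Z0 : 0 < Z.
  have [B B0 HB] := compact_bound Yc cr.
  have HZ : `|I (fun y => r y * h y)| <= B * Z.
    rewrite /Z -RintZ//; apply: Rint_norm_le => //; first exact: cont_onM.
      by apply: cont_onM => //; exact: cont_on_cst.
    by move=> y Yy; rewrite normrM (ger0_norm (h_ge0 _ Yy)) ler_wpM2r ?h_ge0 ?HB.
  rewrite -(pmulr_rgt0 _ B0); apply: lt_le_trans HZ.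
  by rewrite normr_gt0 lt_eqF.
(* This is h / v_i without its summand delta t_i, which the matching puts back. It is a uniform
   limit of sums of squares, being built from tau, the v_l, the t_l and 1 / v_i. *)
pose w i y := tau y * (vcoord y i)^-1 +
  \sum_(l | l != i) delta * ((vcoord y l * t l y) * (vcoord y i)^-1).
have wE i y : Y y -> w i y + delta * t i y = h y / vcoord y i.
  move=> Yy; have vi := lt0r_neq0 (v_gt0 i Yy).
  rewrite /w -mulr_sumr -mulr_suml /h [T y](bigD1 i)//=; field.
  exact: vi.
have cw_aux i l : cont_on Y (fun y => (vcoord y l * t l y) * (vcoord y i)^-1).
  exact: cont_onM.
have cw i : cont_on Y (w i).
  apply: cont_onD; first exact: cont_onM.
  by apply: cont_on_sum => l _; apply: cont_onM => //; exact: cont_on_cst.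
have lw i : sos_lim Y (w i).
  have liv : sos_lim Y (fun y => (vcoord y i)^-1).
    by apply: sos_limV => // [|y]; [exact: is_poly_vcoord|exact: v_gt0].
  apply: sos_limD; first by apply: sos_limM => //; exact: is_sos_lim.
  apply: sos_lim_sum => l _; apply: sos_limM => //.
  - exact: cont_on_cst.
  - by apply: is_sos_lim; exact/is_sos_cst/ltW.
  apply: sos_limM => //; apply: sos_limM => //; last exact: is_sos_lim.
  by apply: sos_lim_pos => // [|y]; [exact: is_poly_vcoord|exact: v_gt0].
(* p is the matched sum of squares divided by the normalising constant Z. *)
have /choice[p Hp] : forall i, exists p : mpoly (N.+1 + N.+1) R,
    (exists d, sos d p) /\ forall j,
    Z * I (fun y => phi i j y * peval p y) =
    I (fun y => phi i j y / vcoord y i * h y).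
  move=> i; have [q qs Hq] := (Ht i).2 _ _ (cw i) (lw i) delta0.
  have [d [p [pd pE]]] : exists d sigma,
      sos d sigma /\ (fun y => Z^-1 * q y) = peval sigma.
    by apply: sos_of_is_sos; apply: is_sosZ => //; rewrite invr_ge0 ltW.
  have cq : cont_on Y q by exact/is_poly_cont/is_sos_poly.
  exists p; split => [|j]; first by exists d.
  rewrite -pE.
  have -> : I (fun y => phi i j y / vcoord y i * h y) = I (fun y => phi i j y * q y).
    by rewrite Hq; apply: Rint_eq => y Yy; rewrite wE// [RHS]mulrA [LHS]mulrAC.
  rewrite -RintZ//; first by apply: Rint_eq => y _; field; rewrite gt_eqF.
  by apply: cont_onM => //; apply: cont_onM => //; exact: cont_on_cst.
have /choice[d Hd] : forall i, exists d, sos d (p i) by move=> i; case: (Hp i).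
(* The factor v_i cancels 1 / v_i, so the moments no longer depend on i. *)
have Hm i (a b : 'I_N.+1 -> nat) : (\sum_j (a j + b j) <= s)%N ->
    Z * I (fun y => monom a b y * vcoord y i * peval (p i) y) =
    I (fun y => monom a b y * h y).
  move=> abs.
  have abl l : (a l < s.+1)%N /\ (b l < s.+1)%N.
    rewrite !ltnS; split; apply: leq_trans abs; rewrite (bigD1 l)//= -addnA.
      exact: leq_addr.
    by rewrite addnCA leq_addr.
  pose j : option (X * X) := Some ([ffun l => inord (a l)], [ffun l => inord (b l)]).
  have jE y : phi i j y = monom a b y * vcoord y i.
    congr (_ * _); apply: eq_bigr => l _ /=.
    by rewrite !ffunE !inordK; case: (abl l).
  transitivity (Z * I (fun y => phi i j y * peval (p i) y)).
    by congr (_ * _); apply: Rint_eq => y _; rewrite jE.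
  rewrite (Hp i).2; apply: Rint_eq => y Yy.
  by rewrite jE mulfK// gt_eqF// v_gt0.
have ZI (x x' : R) : Z * x = Z * x' -> x = x' by apply: mulfI; rewrite gt_eqF.
(* The sum of the orders is a common order for all i. *)
exists (\sum_i d i)%N, p; split.
- by move=> i; apply: sosW (Hd i); rewrite (bigD1 i)//= leq_addr.
- by move=> i a b abs; apply: ZI; rewrite !Hm.
- have m1 y : monom (fun=> 0%N) (fun=> 0%N) y = 1 :> R.
    by rewrite /monom big1// => l _; rewrite !expr0 mulr1.
  apply: ZI; have := Hm ord0 (fun=> 0%N) (fun=> 0%N).
  rewrite big1// => /(_ isT) E.
  transitivity (Z * I (fun y => monom (fun=> 0%N) (fun=> 0%N) y
      * vcoord y ord0 * peval (p ord0) y)).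
    by congr (_ * _); apply: Rint_eq => y _; rewrite m1 mul1r.
  by rewrite E mulr1; apply: Rint_eq => y _; rewrite m1 mul1r.
rewrite -(ler_pM2l Z0) mulr_sumr.
have -> : \sum_i Z * I (fun y => ucoord y i * peval (p i) y) =
    I (fun y => ratio_sum y * h y).
  transitivity (I (fun y => \sum_i (ucoord y i / vcoord y i) * h y)).
    rewrite Rint_sum//; last first.
      by move=> i _; apply: cont_onM => //; exact: cont_on_ratio.
    by apply: eq_bigr => i _; exact: ((Hp i).2 None).
  by apply: Rint_eq => y _; rewrite mulr_suml.
rewrite -subr_le0.
have -> : Z * (ratio_sum y0 + eta) = I (fun y => (ratio_sum y0 + eta) * h y).
  by rewrite RintZ// mulrC.
rewrite -RintB//; last first.
- by apply: cont_onM => //; exact: cont_on_cst.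
- by apply: cont_onM => //; exact: cont_on_ratio_sum.
apply: le_trans (ltW Irh); rewrite le_eqVlt; apply/orP; left; apply/eqP.
by apply: Rint_eq => y _; rewrite /r mulrBl.
Qed.

End ExactDensities.

(** * Lower bound for the objective *)

Section LowerBound.
Variables (R : realType) (N : nat) (Y : set 'rV[R]_(N.+1 + N.+1)).
Variable nu : {measure set (borelRV R (N.+1 + N.+1)) -> \bar R}.
Hypotheses (Yc : compact Y) (nuY : (nu Y < +oo)%E).
Hypothesis v_gt0 : forall y i, Y y -> 0 < vcoord y i.

Local Notation I h := (Rintegral nu Y h).

Let cu i : cont_on Y (fun y => ucoord y i).
Proof. exact/is_poly_cont/is_poly_ucoord. Qed.

Let cv i : cont_on Y (fun y => vcoord y i).
Proof. exact/is_poly_cont/is_poly_vcoord. Qed.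

(** The geometric series approximates 1 / v_i within eta / B, where B bounds u_i. A univariate q is
    enough, and then only the monomials u_i v_i^j occur. *)
Lemma ratio_poly_approx i (eta : R) : 0 < eta ->
  exists q : {poly R}, forall y, Y y ->
    `|ucoord y i / vcoord y i - ucoord y i * q.[vcoord y i]| <= eta.
Proof.
move=> eta0.
have [a [b [a0 ab Hab]]] : exists a b,
    [/\ 0 < a, a <= b & forall y, Y y -> a <= vcoord y i <= b].
  by apply: pos_bounds => // [|y]; [exact: is_poly_vcoord|exact: v_gt0].
have [B B0 HB] := compact_bound Yc (@cu i).
have [m Hm] := invr_geometric a0 ab (divr_gt0 eta0 B0).
exists (b^-1 *: \sum_(l < m) (1 - b^-1 *: 'X) ^+ l) => y Yy.
rewrite hornerZ horner_sum -mulrBr normrM.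
under eq_bigr do rewrite horner_exp hornerD hornerN hornerZ hornerC hornerX mulrC.
have -> : eta = B * (eta / B) by rewrite mulrC divfK// gt_eqF.
apply: ler_pM => //; first exact: HB.
exact: Hm (leqnn _) _ (Hab _ Yy).
Qed.

Section Fixed.
Variables (s : nat) (eps eta : R) (q : 'I_N.+1 -> {poly R}).
Variable sigma : 'I_N.+1 -> mpoly (N.+1 + N.+1) R.
Hypotheses (eps0 : 0 <= eps) (eps1 : eps <= 1) (eta0 : 0 <= eta).
Hypothesis qs : forall i, (size (q i) <= s)%N.
Hypothesis q_approx : forall i y, Y y ->
    `|ucoord y i / vcoord y i - ucoord y i * (q i).[vcoord y i]| <= eta.
Hypothesis sigma_ge0 : forall i y, 0 <= peval (sigma i) y.
Hypothesis constr : forall (i : 'I_N.+1) (a b : 'I_N.+1 -> nat),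
  i != ord0 -> (\sum_j (a j + b j) <= s)%N ->
  `|I (fun y => monom a b y * vcoord y i * peval (sigma i) y)
    - I (fun y => monom a b y * vcoord y ord0 * peval (sigma ord0) y)| <= eps.
Hypothesis mass1 : `|I (fun y => vcoord y ord0 * peval (sigma ord0) y) - 1| <= eps.

(** The nonnegative densities whose moments the constraints compare. *)
Let m i (y : 'rV[R]_(N.+1 + N.+1)) := vcoord y i * peval (sigma i) y.

Let cm i : cont_on Y (m i).
Proof. by apply: cont_onM => //; exact: cont_on_peval. Qed.

Let m_ge0 i y : Y y -> 0 <= m i y.
Proof. by move=> Yy; apply: mulr_ge0 => //; exact/ltW/v_gt0. Qed.

Let constrE (i : 'I_N.+1) (a b : 'I_N.+1 -> nat) : (\sum_j (a j + b j) <= s)%N ->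
  `|I (fun y => monom a b y * m i y) - I (fun y => monom a b y * m ord0 y)| <= eps.
Proof.
move=> abs; have [->|i0] := eqVneq i ord0; first by rewrite subrr normr0.
rewrite (Rint_eq _ (h2 := fun y =>
  monom a b y * vcoord y i * peval (sigma i) y)); last first.
  by move=> y _; rewrite mulrA.
rewrite (Rint_eq _ (h1 := fun y => monom a b y * m ord0 y)
  (h2 := fun y => monom a b y * vcoord y ord0 * peval (sigma ord0) y)); last first.
  by move=> y _; rewrite mulrA.
exact: constr.
Qed.

Let mass0_le : I (m ord0) <= 2.
Proof.
have : `|I (m ord0) - 1| <= eps := mass1.
by rewrite ler_norml => /andP[_]; have := eps1; lra.
Qed.

(** The constraint with all exponents zero puts this mass within eps <= 1 of I (m ord0) <= 2. *)
Let mass_le i : I (m i) <= 3.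
Proof.
have m1 y : monom (fun=> 0%N) (fun=> 0%N) y = 1 :> R.
  by rewrite /monom big1// => l _; rewrite !expr0 mulr1.
have := @constrE i (fun=> 0%N) (fun=> 0%N); rewrite big1// => /(_ isT).
rewrite (Rint_eq _ (h2 := m i)); last by move=> y _; rewrite m1 mul1r.
rewrite (Rint_eq _ (h1 := fun y => _ * m ord0 y) (h2 := m ord0)); last first.
  by move=> y _; rewrite m1 mul1r.
rewrite ler_norml => /andP[_]; have := mass0_le; have := eps1; lra.
Qed.

Let p i (y : 'rV[R]_(N.+1 + N.+1)) := ucoord y i * (q i).[vcoord y i].

Let pE i y : p i y = \sum_(j < size (q i)) (q i)`_j *
  monom (fun l => (l == i) : nat) (fun l => if l == i then j : nat else 0%N) y.
Proof.
rewrite /p horner_coef mulr_sumr; apply: eq_bigr => j _.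
rewrite /monom (bigD1 i)//= eqxx expr1 big1 ?mulr1.
  by rewrite mulrCA.
by move=> l /negPf ->; rewrite !expr0 mulr1.
Qed.

Let cp i : cont_on Y (p i).
Proof.
apply: (eq_cont_on (pE i)); apply: cont_on_sum => j _.
by apply: cont_onM; [exact: cont_on_cst|exact/is_poly_cont/is_poly_monom].
Qed.

Let cr i : cont_on Y (fun y => ucoord y i / vcoord y i).
Proof. exact: cont_on_ratio. Qed.

Let compare_constr i :
  `|I (fun y => p i y * m i y) - I (fun y => p i y * m ord0 y)|
    <= eps * \sum_(j < size (q i)) `|(q i)`_j|.
Proof.
pose mon (j : nat) := @monom R N.+1 (fun l => (l == i) : nat)
  (fun l => if l == i then j : nat else 0%N).
have cmon j l : cont_on Y (fun y => mon j y * m l y).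
  by apply: cont_onM => //; exact/is_poly_cont/is_poly_monom.
have IpE l : I (fun y => p i y * m l y) =
    \sum_(j < size (q i)) (q i)`_j * I (fun y => mon j y * m l y).
  transitivity (I (fun y => \sum_(j < size (q i)) (q i)`_j * (mon j y * m l y))).
    apply: Rint_eq => y _; rewrite pE mulr_suml; apply: eq_bigr => j _.
    by rewrite -mulrA.
  rewrite Rint_sum//; last by move=> j _; apply: cont_onM => //; exact: cont_on_cst.
  by apply: eq_bigr => j _; rewrite RintZ.
rewrite !IpE -sumrB mulr_sumr (le_trans (ler_norm_sum _ _ _))//.
apply: ler_sum => j _; rewrite -mulrBr normrM mulrC ler_wpM2r//.
(* The monomial u_i v_i^j has degree j + 1, and j < size (q i) <= s. *)
apply: constrE; rewrite (bigD1 i)//= eqxx big1 ?addn0 => [|l /negPf -> //].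
exact: leq_trans (ltn_ord j) (qs i).
Qed.

Let compare_ratio i l :
  `|I (fun y => p i y * m l y) - I (fun y => ucoord y i / vcoord y i * m l y)|
    <= eta * I (m l).
Proof.
rewrite -RintB//; [|exact: cont_onM|exact: cont_onM].
rewrite -RintZ//; apply: Rint_norm_le => //.
- by apply: cont_onB; exact: cont_onM.
- by apply: cont_onM => //; exact: cont_on_cst.
move=> y Yy; rewrite -mulrBl normrM (ger0_norm (m_ge0 _ Yy)).
by rewrite ler_wpM2r ?m_ge0// distrC q_approx.
Qed.

(** Write u_i sigma_i as (u_i / v_i) m_i. Passing to p_i m_i costs 3 eta, to p_i m_0 costs eps times
    the sum of the absolute coefficients of q_i, and back to (u_i / v_i) m_0 costs 2 eta. What
    remains is at least rho I (m_0), and I (m_0) is within eps of 1. *)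
Lemma objective_lower_bound (rho : R) :
  (forall y, Y y -> rho <= ratio_sum y) ->
  rho - (5 * eta) *+ N.+1
    - eps * (`|rho| + \sum_i \sum_(j < size (q i)) `|(q i)`_j|) <=
  \sum_i I (fun y => ucoord y i * peval (sigma i) y).
Proof.
move=> rhoY.
have term i : I (fun y => ucoord y i / vcoord y i * m ord0 y) - 5 * eta
      - eps * (\sum_(j < size (q i)) `|(q i)`_j|) <=
    I (fun y => ucoord y i * peval (sigma i) y).
  have -> : I (fun y => ucoord y i * peval (sigma i) y) =
      I (fun y => ucoord y i / vcoord y i * m i y).
    apply: Rint_eq => y Yy; rewrite /m mulrA divfK//.
    by rewrite gt_eqF// v_gt0.
  have e1 : eta * I (m i) <= eta * 3 by rewrite ler_wpM2l.
  have e2 : eta * I (m ord0) <= eta * 2 by rewrite ler_wpM2l.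
  have := compare_ratio i i; have := compare_ratio i ord0.
  have := compare_constr i.
  rewrite !ler_norml => /andP[A _] /andP[B _] /andP[_ C]; lra.
apply: le_trans (ler_sum _ (fun i _ => term i)).
rewrite !sumrB sumr_const card_ord mulrDr -mulr_sumr.
suff : rho - eps * `|rho| <= \sum_i I (fun y => ucoord y i / vcoord y i * m ord0 y).
  lra.
rewrite -Rint_sum//; last by move=> i _; exact: cont_onM.
apply: (@le_trans _ _ (rho * I (m ord0))); last first.
  rewrite -RintZ//; apply: Rint_le => //.
  - by apply: cont_onM => //; exact: cont_on_cst.
  - by apply: cont_on_sum => i _; exact: cont_onM.
  by move=> y Yy; rewrite -mulr_suml ler_wpM2r ?m_ge0 ?rhoY.
have : `|rho * (I (m ord0) - 1)| <= `|rho| * eps.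
  by rewrite normrM ler_wpM2l.
rewrite ler_norml => /andP[+ _]; lra.
Qed.

End Fixed.

Lemma objective_liminf (rho delta : R) : 0 < delta ->
    (forall y, Y y -> rho <= ratio_sum y) ->
  exists S : nat, exists2 e0 : R, 0 < e0 & forall s eps sigma,
    (S <= s)%N -> 0 < eps -> eps < e0 ->
    (forall i y, 0 <= peval (sigma i) y) ->
    (forall (i : 'I_N.+1) (a b : 'I_N.+1 -> nat),
      i != ord0 -> (\sum_j (a j + b j) <= s)%N ->
      `|I (fun y => monom a b y * vcoord y i * peval (sigma i) y)
      - I (fun y => monom a b y * vcoord y ord0 * peval (sigma ord0) y)| <= eps) ->
    `|I (fun y => vcoord y ord0 * peval (sigma ord0) y) - 1| <= eps ->
    rho - delta <= \sum_i I (fun y => ucoord y i * peval (sigma i) y).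
Proof.
move=> delta0 rhoY.
(* The N + 1 errors 5 eta add up to delta / 2; the threshold on eps below keeps eps C under the
   other half. *)
pose eta : R := delta / (10 * N.+1%:R).
have N0 : 0 < N.+1%:R :> R by rewrite ltr0n.
have eta0 : 0 < eta by rewrite divr_gt0// mulr_gt0.
have /choice[q Hq] := fun i => ratio_poly_approx i eta0.
pose C := `|rho| + \sum_i \sum_(j < size (q i)) `|(q i)`_j|.
have C0 : 0 <= C.
  by rewrite addr_ge0// sumr_ge0// => i _; rewrite sumr_ge0.
exists (\sum_i size (q i))%N, (Num.min 1 (delta / (2 * (C + 1)))).
  by rewrite lt_min ltr01 divr_gt0// mulr_gt0// ltr_wpDl.
move=> s eps sigma Ss eps0; rewrite lt_min => /andP[eps1 epsC] sg con mass.
have qs i : (size (q i) <= s)%N.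
  by apply: leq_trans Ss; rewrite (bigD1 i)//= leq_addr.
apply: le_trans (objective_lower_bound (ltW eps0) (ltW eps1) (ltW eta0)
  qs Hq sg con mass rhoY).
rewrite -/C -mulr_natr.
have -> : 5 * eta * N.+1%:R = delta / 2 by rewrite /eta; field; rewrite gt_eqF.
have : eps * (2 * (C + 1)) < delta by rewrite -ltr_pdivlMr// mulr_gt0// ltr_wpDl.
nra.
Qed.

End LowerBound.

(** * Support and push-forward *)

Section Support.
Variables (R : realType) (n : nat).
Variable mu : {measure set (borelRV R n) -> \bar R}.

(** A Lindelöf argument: every point outside the support lies in a null ball with rational centre
    and radius, and there are countably many such balls. *)
Lemma msupport_compl_negligible : mu.-negligible (~` msupport mu).
Proof.
pose B (qr : 'rV[rat]_n * rat) : set 'rV[R]_n :=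
  ball (map_mx ratr qr.1 : 'rV[R]_n) (ratr qr.2).
pose F (m : nat) : set (borelRV R n) :=
  if unpickle m is Some qr then (if mu (B qr) == 0%E then B qr else set0) else set0.
have : mu.-negligible (\bigcup_m F m).
  apply: negligible_bigcup => m; rewrite /F.
  case: unpickle => [qr|]; last exact: negligible_set0.
  case: eqP => [B0|_]; last exact: negligible_set0.
  by apply/negligibleP => //; apply: borelRV_open; exact: ball_open.
apply: negligibleS => x xS.
have [V [oV Vx V0]] : exists V : set 'rV[R]_n, [/\ open V, V x & mu V = 0%E].
  apply: contrapT => H; apply: xS => V oV Vx.
  by rewrite lt0e measure_ge0 andbT; apply/eqP => V0; apply: H; exists V.
have [e e0 xeV] : exists2 e : R, 0 < e & ball x e `<=` V.
  by have /nbhs_ballP[e e0 xeV] : nbhs x V; [exact: open_nbhs_nbhs|exists e].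
(* With the centre within e / 4 of x and e / 4 < r < e / 2, the rational ball contains x and stays
   inside the ball of radius e around x. *)
have [r /[!in_itv]/= /andP[er re]] : exists r, ratr r \in `](e / 4), (e / 2)[.
  by apply: rat_in_itvoo; lra.
have /choice[q Hq] : forall i, exists q : rat, `|x ord0 i - ratr q| < e / 4.
  move=> i; have [q /[!in_itv]/= qi] : exists q,
      ratr q \in `](x ord0 i - e / 4), (x ord0 i + e / 4)[.
    by apply: rat_in_itvoo; lra.
  by exists q; rewrite ltr_distlC.
pose qr : 'rV[rat]_n * rat := (\row_i q i, r).
have e40 : 0 < e / 4 by rewrite divr_gt0.
have Bx : B qr x.
  split=> [|i j]; first exact: lt_trans er.
  by rewrite ord1 !mxE /ball/= distrC; exact: lt_trans er.
have BV : B qr `<=` V.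
  move=> y [_ By]; apply: xeV; split=> // i j.
  have := By i j; rewrite ord1 !mxE /ball/= => Bj.
  rewrite (le_lt_trans (ler_distD (ratr (q j)) _ _))//.
  have := Hq j; lra.
exists (pickle qr) => //; rewrite /F pickleK.
suff -> : mu (B qr) = 0%E by rewrite eqxx.
apply/eqP; rewrite eq_le measure_ge0 andbT -V0 le_measure// inE.
  by apply: borelRV_open; exact: ball_open.
exact: borelRV_open.
Qed.

(** As the complement of the support is null, intersecting with [K] loses no mass. *)
Lemma msupport_mass (V : set 'rV[R]_n) (x : 'rV[R]_n) (K : set 'rV[R]_n) :
  msupport mu = K -> compact K -> open V -> V x -> K x -> (0 < mu (V `&` K))%E.
Proof.
move=> muK cK oV Vx Kx.
have mK : measurable (K : set (borelRV R n)) by exact: borelRV_compact.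
have mV : measurable (V : set (borelRV R n)) by exact: borelRV_open.
have V0 : (0 < mu V)%E by move: Kx; rewrite -muK; exact.
have : (mu V <= mu (V `&` K) + mu (~` K))%E.
  rewrite -[in leLHS](setIT V) -(setUv K) setIUr.
  have mVc : measurable (V `&` ~` K : set (borelRV R n)).
    by apply: measurableI => //; exact: measurableC.
  rewrite (le_trans (measureU2 _ _ _))//; first exact: measurableI.
  by rewrite leeD2l// le_measure// inE//; exact: measurableC.
have -> : mu (~` K) = 0%E.
  apply/negligibleP; first exact: measurableC.
  by rewrite -muK; exact: msupport_compl_negligible.
by rewrite adde0; exact: lt_le_trans.
Qed.

End Support.

Section Pushforward.
Variables (R : realType) (n N : nat) (f g : 'I_N -> mpoly n R).

Lemma Umap_u x i : ucoord (Umap f g x) i = peval (f i) x.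
Proof. by rewrite /ucoord row_mxEl mxE. Qed.

Lemma Umap_v x i : vcoord (Umap f g x) i = peval (g i) x.
Proof. by rewrite /vcoord row_mxEr mxE. Qed.

Lemma ratio_sum_Umap x : ratio_sum (Umap f g x) = sum_ratios f g x.
Proof. by apply: eq_bigr => i _; rewrite Umap_u Umap_v. Qed.

Lemma Umap_continuous : continuous (Umap f g).
Proof.
move=> x A [P nP sPA].
have : \forall z \near x, forall i j, P i j (Umap f g z i j).
  pose G i j : set 'rV[R]_n := [set z | P i j (Umap f g z i j)].
  apply: (@filter_forall _ _ (fun i => [set z | forall j, G i j z])
    _ (nbhs_filter x)) => i.
  apply: (@filter_forall _ _ (G i) _ (nbhs_filter x)) => j; rewrite /G /=.
  rewrite [i]ord1; move: (nP ord0 j); case: (split_ordP j) => l ->.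
    rewrite row_mxEl mxE => nPl.
    have := @cont_on_peval _ _ setT (f l) x I _ nPl.
    apply: (@filterS _ (nbhs x)) => z /=.
    by rewrite /Umap row_mxEl mxE.
  rewrite row_mxEr mxE => nPl.
  have := @cont_on_peval _ _ setT (g l) x I _ nPl.
  apply: (@filterS _ (nbhs x)) => z /=.
  by rewrite /Umap row_mxEr mxE.
by apply: filterS => z /sPA.
Qed.

Lemma Umap_measurable :
  measurable_fun setT (Umap f g : borelRV R n -> borelRV R (N + N)).
Proof.
apply: (@measurability _ _ (borelRV R n) (borelRV R (N + N)) setT _
  (@open 'rV[R]_(N + N)) erefl) => _ [V oV <-]; rewrite setTI.
by apply: borelRV_open; apply: open_comp => // x _; exact: Umap_continuous.
Qed.

End Pushforward.

(** * Convergence of the hierarchy *)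

Lemma minimum_eq (R : realType) (A : set R) (m : R) :
  A m -> lbound A m -> minimum A = m.
Proof.
move=> Am lm; have [Ax lx] : (A `&` lbound A) (minimum A).
  by apply: (xgetPex 0 (P := A `&` lbound A)); exists m.
by apply/eqP; rewrite eq_le lx//= lm.
Qed.

(** The two finite bounds also force u to be finite near the limit, which matters because
    [rho_sharp] may be infinite elsewhere. *)
Lemma cvg_EFin_between (R : realType) (T : Type) (F : set_system T)
    (u : T -> \bar R) (l : R) : Filter F ->
  (forall e : R, 0 < e ->
    \forall x \near F, ((l - e)%:E <= u x <= (l + e)%:E)%E) ->
  u @ F --> l%:E.
Proof.
move=> FF H; apply/fine_cvgP; split.
  apply: filterS (H _ ltr01) => x; case: (u x) => [r| |] //.
    by rewrite leye_eq andbF.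
apply/cvgrPdist_le => e e0; apply: filterS (H _ e0) => x /=.
case: (u x) => [r| |]; rewrite ?leye_eq ?andbF ?leeNy_eq//= !lee_fin.
by rewrite distrC ler_distl.
Qed.

Theorem mainTheorem3 (R : realType) (n N : nat) (K : set 'rV[R]_n)
    (lambda : {finite_measure set (borelRV R n) -> \bar R})
    (f g : 'I_N.+1 -> mpoly n R)
    (K_nonempty : K !=set0)
    (K_compact : compact K)
    (K_support : msupport lambda = K)
    (g_pos : forall (i : 'I_N.+1) (x : 'rV[R]_n), K x -> 0 < peval (g i) x) :
  exists d0 : nat -> nat,
    (forall s : nat, (0 < d0 s)%N) /\
    forall d : nat -> R -> nat,
      (forall (s : nat) (eps : R), (d0 s <= d s eps)%N) ->
      rho_sharp K lambda f g p.1 (d p.1 p.2) p.2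
        @[p --> filter_prod \oo (0 : R)^'+]
        --> (minimum (sum_ratios f g @` K))%:E.
Proof.
pose U := Umap f g; pose Y := U @` K.
pose nu : {measure set (borelRV R (N.+1 + N.+1)) -> \bar R} :=
  measure_function_pushforward__canonical__measure_function_Measure lambda
    (Umap_measurable f g).
have Yc : compact Y.
  apply: continuous_compact => //; apply: continuous_subspaceT.
  exact: Umap_continuous.
have v_gt0 y i : Y y -> 0 < vcoord y i.
  by move=> [x Kx <-]; rewrite Umap_v; exact: g_pos.
have mY : measurable (Y : set (borelRV R (N.+1 + N.+1))) by exact: borelRV_compact.
have mU := @Umap_measurable R n N.+1 f g.
have mUV (V : set (borelRV R (N.+1 + N.+1))) : measurable V ->
    measurable (U @^-1` V : set (borelRV R n)).
  by move=> mV; rewrite -[X in measurable X]setTI; exact: mU.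
have nuY : (nu Y < +oo)%E.
  by rewrite ltey_eq; apply/orP; left; apply: fin_num_measure; exact: mUV.
have [x0 Kx0 x0min] : exists2 x0, K x0 &
    forall x, K x -> sum_ratios f g x0 <= sum_ratios f g x.
  apply: compact_min => //; apply: cont_on_sum => i _.
  apply: cont_onM; first exact: cont_on_peval.
  by apply: cont_onV; [move=> x /g_pos/lt0r_neq0|exact: cont_on_peval].
have -> : minimum (sum_ratios f g @` K) = sum_ratios f g x0.
  apply: minimum_eq; first by exists x0.
  by move=> _ [x Kx <-]; exact: x0min.
set rho := sum_ratios f g x0.
have rhoY y : Y y -> rho <= ratio_sum y.
  by move=> [x Kx <-]; rewrite ratio_sum_Umap; exact: x0min.
have mass (e : R) : 0 < e -> (0 < nu (ball (U x0) e `&` Y))%E.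
  move=> e0; have oB : open (U @^-1` ball (U x0) e).
    by apply: open_comp; [move=> x _; exact: Umap_continuous|exact: ball_open].
  apply: lt_le_trans (msupport_mass K_support K_compact oB (ballxx _ e0) Kx0) _.
  apply: le_measure; rewrite ?inE.
  - by apply: measurableI; [exact: borelRV_open|exact: borelRV_compact].
  - apply: mUV; apply: measurableI => //.
    by apply: borelRV_open; exact: ball_open.
  - by move=> x [Bx Kx]; split => //; exists x.
have Yx0 : Y (U x0) by exists x0.
have inv_gt0 (s : nat) : 0 < s.+1%:R^-1 :> R by rewrite invr_gt0 ltr0n.
(* The tolerance eta = 1 / (s + 1) tends to 0 with s and makes the order a function of s only. *)
have /choice[d0 Hd0] := fun s => exact_densities Yc nuY v_gt0 Yx0 mass s (inv_gt0 s).
have upper s d eps : (d0 s <= d)%N -> 0 < eps ->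
    (rho_sharp K lambda f g s d eps <= (rho + s.+1%:R^-1)%:E)%E.
  move=> d0d eps0; have [sigma [sos_s constr mass1 obj]] := Hd0 s.
  apply: ge_ereal_inf; exists (\sum_i Rintegral nu Y
      (fun y => ucoord y i * peval (sigma i) y))%:E; last first.
    by rewrite lee_fin; move: obj; rewrite ratio_sum_Umap.
  exists sigma => //; split.
  - by move=> i; exact: sosW d0d (sos_s i).
  - move=> i a b _ abs; have E := constr i a b abs.
    (* [intU] is convertible to the integral over [Y] against [nu]. *)
    rewrite -[X in `|X - _|]/(Rintegral nu Y _) -[X in `|_ - X|]/(Rintegral nu Y _).
    by rewrite E subrr normr0 ltW.
  - rewrite -[X in `|X - _|]/(Rintegral nu Y _).
    by rewrite mass1 subrr normr0 ltW.
(* The successor makes the order positive. *)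
exists (fun s => (d0 s).+1); split=> // d Hd.
apply: cvg_EFin_between => e e0.
have [S [e1 e10 lower]] := objective_liminf Yc nuY v_gt0 e0 rhoY.
have [m Hm] : exists m : nat, m.+1%:R^-1 <= e.
  exists (Num.bound e^-1); rewrite invf_ple ?posrE ?ltr0n//.
  have /archi_boundP/ltW/le_trans : 0 <= e^-1 by rewrite invr_ge0 ltW.
  by apply; rewrite ler_nat.
exists ([set s | (maxn S m <= s)%N], [set eps | 0 < eps /\ eps < e1]) => /=.
  split; first by exists (maxn S m).
  near=> eps; split; near: eps; first exact: nbhs_right_gt.
  exact: nbhs_right_lt.
move=> [s eps] /= [sSm [eps0 eps1]].
move: sSm; rewrite geq_max => /andP[sS sm].
apply/andP; split.
  apply: le_ereal_inf_tmp => _ [sigma [sos_s constr mass1] <-].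
  rewrite lee_fin; apply: (lower s eps sigma) => //.
  move=> i y; have [_ [qs ->]] := sos_s i.
  by rewrite /peval rmorph_sum/= sumr_ge0// => q _; rewrite rmorphXn sqr_ge0.
apply: le_trans (upper s _ eps _ eps0) _; first by apply: ltnW; exact: Hd.
rewrite lee_fin lerD2l; apply: le_trans Hm.
by rewrite lef_pV2 ?posrE ?ltr0n// ler_nat.
Unshelve. all: by end_near. Qed.
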